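(* Assume (GW1), (GW2) and (GW3). Let $\Phi:\mathbb Z\to\mathbb C^{1\times J}$ be a deterministic characteristic and $(Z_n^\Phi)_{n\ge0}$ the associated branching process counted with characteristic $\Phi$. Then: i) If $\sum_{k\in\mathbb Z}\|\Phi(k)\|\rho^{-k}<\infty$, then with $\sigma_\Phi^2=\sum_{k\in\mathbb Z}\Phi(k)\rho^{-k}\mathrm u$ we have $$\lim_{n\to\infty}\frac{Z_n^\Phi}{\rho^n}=\sigma_\Phi^2W\quad\text{almost surely}.$$ ii) If for some $\gamma\ge0$ and some $\sigma^2\in\mathbb C$ the following three conditions hold: $$\sup_{n\ge1}\frac1{n^\gamma}\sum_{k=-\infty}^n\|\Phi(k)\|\rho^{-k}<\infty,\qquad \lim_{n\to\infty}\frac{1}{n^\gamma\rho^n}\|\Phi(n)\|=0,\qquad \lim_{n\to\infty}\frac1{n^\gamma}\sum_{k=-\infty}^n\Phi(k)\rho^{-k}\mathrm u=\sigma^2,$$ then $$\lim_{n\to\infty}\frac{Z_n^\Phi}{n^\gamma\rho^n}=\sigma^2W\quad\text{almost surely}.$$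
   Context: Branching process. Fix $J\ge1$, $[J]=\{1,\dots,J\}$. Vectors are column vectors and $\mathrm e_j$ is the $j$-th standard basis vector. Let $L^{(1)},\dots,L^{(J)}$ be independent random column vectors with nonnegative integer entries, $L^{(j)}=(L^{(j,1)},\dots,L^{(j,J)})$, where $L^{(j,i)}$ is the number of children of type $i$ of a particle of type $j$ (entries of the same $L^{(j)}$ may be dependent). $L$ is the $J\times J$ random matrix with columns $L^{(1)},\dots,L^{(J)}$, and $A=\mathbb E L$. Let $\mathcal U_\infty=\bigcup_{n\ge0}\{1,2,\dots\}^n$ be the Ulam–Harris tree with root $\varnothing$ (empty word), $|u|$ the length of $u$, and $(L(u))_{u\in\mathcal U_\infty}$ i.i.d. copies of $L$. For a fixed initial type $i_0\in[J]$ the random tree $\mathbb T\subset\mathcal U_\infty$ and type function $\mathrm t:\mathbb T\to[J]$ are defined by: $\varnothing\in\mathbb T$, $\mathrm t(\varnothing)=i_0$; if $u\in\mathbb T$ has $\mathrm t(u)=j$, then $uk\in\mathbb T$ iff $k\le\sum_{i=1}^JL^{(j,i)}(u)$, and $\mathrm t(uk)=l$ when $\sum_{i<l}L^{(j,i)}(u)<k\le\sum_{i\le l}L^{(j,i)}(u)$. $Z_n=(Z_n^1,\dots,Z_n^J)$ with $Z_n^i=\#\{u\in\mathbb T:|u|=n,\mathrm t(u)=i\}$; so $Z_0=\mathrm e_{i_0}$. Assumptions. (GW1): the spectral radius $\rho$ of $A$ satisfies $\rho>1$. (GW2): $A$ is positively regular, i.e. some power $A^n$ has all entries positive. (GW3):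 $\sum_{j=1}^J\mathrm{Cov}[L^{(j)}]\neq\mathbf 0$ (sum of covariance matrices) and all variances $\mathrm{Var}[L^{(i,j)}]$ are finite. By Perron–Frobenius, $\rho$ is a simple eigenvalue of $A$ with right and left eigenvectors $\mathrm u,\mathrm v$ with positive entries, $A\mathrm u=\rho\mathrm u$, $\mathrm v^\top A=\rho\mathrm v^\top$, $\langle\mathrm u,\mathrm v\rangle=1$. $W$ is the scalar random variable (Kesten–Stigum) with $\rho^{-n}Z_n\to W\mathrm u$ almost surely. A deterministic characteristic (of dimension one) is a deterministic function $\Phi:\mathbb Z\to\mathbb C^{1\times J}$. Its associated branching process counted with characteristic $\Phi$ is $$Z_n^\Phi=\sum_{u\in\mathbb T}\Phi(n-|u|)\mathrm e_{\mathrm t(u)}=\sum_{k=-\infty}^n\Phi(k)Z_{n-k}.$$ $\|\cdot\|$ is the Hilbert–Schmidt (Euclidean) norm. *)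

(* Defs.v *)
From HB Require Import structures.
From mathcomp Require Import all_boot all_order all_algebra finmap.
From mathcomp Require Import complex.
From mathcomp Require Import all_classical all_reals all_analysis.

Set Implicit Arguments.
Unset Strict Implicit.
Unset Printing Implicit Defensive.

Import Order.TTheory GRing.Theory Num.Theory.
Import numFieldNormedType.Exports.

Local Open Scope classical_set_scope.
Local Open Scope ring_scope.
Local Open Scope complex_scope.

(* The library puts no topology on R[i] itself, but does on the convertible
   type R[i]^o: limits of complex sequences are taken there. *)
Notation "u '-->C' l" :=
  ((fun n : nat => (u n : _[i]^o)) @ \oo --> (l : _[i]^o)) (at level 70).

Section ComplexSums.
Variables (R : realType) (I : choiceType).
Implicit Types (D : set I) (f : I -> R[i]).

Definition cmod (z : R[i]) : R := Normc.normc z.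

Definition csummable D f : Prop :=
  (\esum_(i in D) (cmod (f i))%:E < +oo)%E.

(* Meaningful only for absolutely summable families. *)
Definition rsum D (g : I -> R) : R :=
  fine (\esum_(i in D) (Num.max (g i) 0)%:E)
  - fine (\esum_(i in D) (Num.max (- g i) 0)%:E).

Definition csum D f : R[i] :=
  rsum D (fun i => complex.Re (f i)) +i* rsum D (fun i => complex.Im (f i)).

End ComplexSums.

Section Matrices.
Variable R : realType.

Definition cmx m n (A : 'M[R]_(m, n)) : 'M[R[i]]_(m, n) :=
  map_mx (real_complex R) A.

Definition hsnorm m n (A : 'M[R[i]]_(m, n)) : R :=
  Num.sqrt (\sum_i \sum_j cmod (A i j) ^+ 2).

Definition spectral_radius J (A : 'M[R]_J) : R :=
  sup [set cmod z | z in [set z : R[i] | eigenvalue (cmx A) z]].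

End Matrices.

Section Probability.
Context d (T : measurableType d) (R : realType) (P : probability T R).

(* Mutual independence of random elements of a countable set carrying its
   discrete sigma-algebra, so that every B i is an event. *)
Definition independent_family (I : choiceType) (S : countType)
    (X : I -> T -> S) : Prop :=
  forall (F : {fset I}) (B : I -> set S),
    fine (P (\bigcap_(i in [set` F]) (X i @^-1` B i)))
    = \prod_(i <- F) fine (P (X i @^-1` B i)).

Definition same_law (S : countType) (X Y : T -> S) : Prop :=
  forall B : set S, P (X @^-1` B) = P (Y @^-1` B).

Variable J : nat.

(* Column j of an offspring matrix L is the vector L^(j); thus the entry
   L i j is L^(j,i), the number of children of type i of a type-j particle. *)
Definition measurable_mx (L : T -> 'M[nat]_J) : Prop :=
  forall i j, measurable_fun [set: T] (fun w => L w i j).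

Definition entry (L : T -> 'M[nat]_J) (i j : 'I_J) : T -> R :=
  fun w => (L w i j)%:R.

Definition mean_mx (L : T -> 'M[nat]_J) : 'M[R]_J :=
  \matrix_(i, j) fine ('E_P[entry L i j]).

Definition col_cov (L : T -> 'M[nat]_J) (j : 'I_J) : 'M[R]_J :=
  \matrix_(a, b) fine (covariance P (entry L a j) (entry L b j)).

End Probability.

(* Ulam-Harris words are encoded with letters shifted by one: the letter k
   stands for the (k+1)-st child, so that every word in seq nat is a vertex. *)
Section Tree.
Variable J : nat.
Implicit Types (M : 'M[nat]_J) (l : seq nat -> 'M[nat]_J).
Implicit Types (i j : 'I_J) (u w : seq nat).

Definition child_type M j (k : nat) : option 'I_J :=
  [pick i : 'I_J | (\sum_(a < J | a < i) M a j <= k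
                    < \sum_(a < J | a <= i) M a j)%N].

Fixpoint label_from l w j u : option 'I_J :=
  match u with
  | [::] => Some j
  | k :: u' => if child_type (l w) j k is Some i
               then label_from l (rcons w k) i u' else None
  end.

(* Some (type of u) if u belongs to the tree, None otherwise. *)
Definition label l i0 u : option 'I_J := label_from l [::] i0 u.

Definition tree l i0 : set (seq nat) := [set u | isSome (label l i0 u)].

Definition vtype l i0 u : 'I_J := odflt i0 (label l i0 u).

Lemma label_nil l i0 : label l i0 [::] = Some i0.
Proof. by []. Qed.

Lemma label_rcons l i0 u k :
  label l i0 (rcons u k) =
  if label l i0 u is Some j then child_type (l u) j k else None.
Proof.
rewrite /label -[X in child_type (l X)]/([::] ++ u).
elim: u [::] i0 => [|k' u IHu] w j /=; first by rewrite cats0; case: child_type.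
by case: child_type => // i; rewrite IHu cat_rcons.
Qed.

Lemma child_type_some M j k :
  isSome (child_type M j k) = (k < \sum_(i < J) M i j)%N.
Proof.
rewrite /child_type; case: pickP => [i /andP[_ lt_k]|noi] /=.
  symmetry; apply: leq_trans lt_k _.
  by rewrite [X in (_ <= X)%N](bigID (fun a : 'I_J => a <= i)%N) leq_addr.
apply/esym/negbTE; rewrite -leqNgt.
have partial_le m : (\sum_(a < J | a < m) M a j <= k)%N.
  elim: m => [|m IHm]; first by rewrite big_pred0.
  have [le_Jm|lt_mJ] := leqP J m.
    rewrite (eq_bigl (fun a : 'I_J => a < m)%N) // => a.
    by rewrite ltnS (leq_trans (ltnW (ltn_ord a))) // (leq_trans (ltn_ord a)).
  by have := noi (Ordinal lt_mJ); rewrite /= IHm /= => /negbT; rewrite -leqNgt.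
apply: leq_trans (partial_le J); rewrite (eq_bigl (fun a : 'I_J => a < J)%N) //.
by move=> a; rewrite ltn_ord.
Qed.

Definition population (R : realType) l i0 (n : nat) : 'cV[R]_J :=
  \col_i #|` fset_set [set u | [/\ tree l i0 u, size u = n
                                 & vtype l i0 u = i]] |%:R.

(* The summand of vertex u in the process counted with characteristic Phi. *)
Definition char_term (R : realType) (Phi : int -> 'rV[R[i]]_J) l i0 (n : nat) u
    : R[i] :=
  (Phi (n%:Z - (size u)%:Z) *m (delta_mx (vtype l i0 u) 0 : 'cV_J)) 0 0.

Definition char_process (R : realType) (Phi : int -> 'rV[R[i]]_J) l i0
    (n : nat) : R[i] :=
  csum (tree l i0) (char_term Phi l i0 n).

End Tree.

(* Main.v *)
(* The argument is pathwise, on the event where [rho^-n Z_n] converges to [W u].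
   Grouping the vertices of the tree by generation gives
   [Z_n^Phi = \sum_m Phi (n - m) Z_m], hence
   [rho^-n Z_n^Phi - W \sum_(k <= n) Phi k rho^-k u
      = \sum_m Phi (n - m) rho^(m - n) (rho^-m Z_m - W u)].
   The last factor tends to 0 as [m] grows, while the weights
   [hsnorm (Phi (n - m)) rho^(m - n)] sum to [O (n^gamma)] and, for fixed [m], are
   [o (n^gamma)], so a Toeplitz argument shows that this is [o (n^gamma)].
   Part i) is part ii) with [gamma = 0]. *)

Require Import Defs.
From HB Require Import structures.
From mathcomp Require Import all_boot all_order all_algebra finmap.
From mathcomp Require Import complex ring lra zify.
From mathcomp Require Import all_classical all_reals all_analysis.

Set Implicit Arguments.
Unset Strict Implicit.
Unset Printing Implicit Defensive.

Import Order.TTheory GRing.Theory Num.Theory.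
Import numFieldNormedType.Exports.

Local Open Scope classical_set_scope.
Local Open Scope ring_scope.
Local Open Scope complex_scope.

(** * Unordered sums of real families and their linearity *)

Lemma sub_esum (R : realType) (I : choiceType) (D D' : set I) (F : I -> \bar R) :
  D `<=` D' -> (\esum_(i in D) F i <= \esum_(i in D') F i)%E.
Proof.
move=> DD'; apply: ereal_sup_le => _ [X [finX XD] <-].
by exists X => //; split=> // x /XD /DD'.
Qed.

Section RealSums.
Context {R : realType} {I : choiceType}.
Implicit Types (D : set I) (f g p q : I -> R).

Lemma esum_EFin_ge0 D p : (forall i, 0 <= p i) ->
  (0 <= \esum_(i in D) (p i)%:E)%E.
Proof. by move=> p0; apply: esum_ge0 => i _; rewrite lee_fin. Qed.

Lemma esum_EFin_fin D p : (forall i, 0 <= p i) ->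
  (\esum_(i in D) (p i)%:E < +oo)%E -> (\esum_(i in D) (p i)%:E)%E \is a fin_num.
Proof. by move=> p0; rewrite ge0_fin_numE ?esum_EFin_ge0. Qed.

Lemma esum_EFinD D p q : (forall i, 0 <= p i) -> (forall i, 0 <= q i) ->
  (\esum_(i in D) (p i + q i)%:E
   = \esum_(i in D) (p i)%:E + \esum_(i in D) (q i)%:E)%E.
Proof.
move=> p0 q0; under eq_esum do rewrite EFinD.
by rewrite esumD// => i _; rewrite lee_fin.
Qed.

(** Finite partial sums give one inequality for every nonnegative factor. For [c > 0], the same
    inequality with factor [c^-1], applied to the family [c * p i], gives the converse. *)
Lemma esum_EFinZl D p (c : R) : 0 <= c -> (forall i, 0 <= p i) ->
  (\esum_(i in D) (c * p i)%:E = c%:E * \esum_(i in D) (p i)%:E)%E.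
Proof.
have half (a : R) h : 0 <= a -> (forall i, 0 <= h i) ->
    (\esum_(i in D) (a * h i)%:E <= a%:E * \esum_(i in D) (h i)%:E)%E.
  move=> a0 h0; apply: ge_ereal_sup => _ [X [finX XD] <-].
  rewrite (eq_fsbigr (fun i => a%:E * (h i)%:E)%E) => [|i _]; last by rewrite EFinM.
  rewrite -ge0_mule_fsumr => [|i]; last by rewrite lee_fin.
  by apply: lee_wpmul2l; rewrite ?lee_fin//; apply: ereal_sup_ubound; exists X.
rewrite le_eqVlt => /predU1P[<- p0|c0 p0].
  by rewrite mul0e esum1// => i _; rewrite mul0r.
apply/eqP; rewrite eq_le half ?(ltW c0)//= muleC -lee_pdivlMr//.
have cp0 i : 0 <= c * p i by rewrite mulr_ge0 ?(ltW c0).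
have ci0 : 0 <= c^-1 by rewrite invr_ge0 ltW.
rewrite muleC; apply: le_trans (half _ _ ci0 cp0).
by apply: le_esum => i _; rewrite mulrA mulVf ?mul1r ?gt_eqF.
Qed.

Lemma maxr0_ge0 (x : R) : 0 <= Num.max x 0.
Proof. by rewrite le_max lexx orbT. Qed.

Lemma maxr0_posneg (x : R) : x = Num.max x 0 - Num.max (- x) 0.
Proof. by case: (leP x); case: (leP (- x)); lra. Qed.

Lemma maxr0_norm (x : R) : `|x| = Num.max x 0 + Num.max (- x) 0.
Proof. by case: (ger0P x) => ?; case: leP; case: leP; lra. Qed.

Lemma eq_rsum D f g : (forall i, D i -> f i = g i) -> rsum D f = rsum D g.
Proof.
by move=> e; congr (fine _ - fine _); apply: eq_esum => i Di; rewrite e.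
Qed.

(** Any splitting of a family into a difference of nonnegative summable families computes [rsum],
    not only the one into positive and negative parts. With [f = p - q], the families [f^+ + q] and
    [p + f^-] coincide; their sums are finite, so the terms can be rearranged. Linearity of [rsum]
    follows by choosing a suitable splitting. *)
Lemma rsum_split D p q :
  (forall i, 0 <= p i) -> (forall i, 0 <= q i) ->
  (\esum_(i in D) (p i)%:E < +oo)%E -> (\esum_(i in D) (q i)%:E < +oo)%E ->
  rsum D (fun i => p i - q i) =
  fine (\esum_(i in D) (p i)%:E) - fine (\esum_(i in D) (q i)%:E).
Proof.
move=> p0 q0 sp sq; pose f i := p i - q i.
have f_pos i := maxr0_ge0 (f i); have f_neg i := maxr0_ge0 (- f i).
have s_pos : (\esum_(i in D) (Num.max (f i) 0)%:E < +oo)%E.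
  apply: le_lt_trans sp; apply: le_esum => i _.
  by rewrite lee_fin ge_max p0 /f gerBl q0.
have s_neg : (\esum_(i in D) (Num.max (- f i) 0)%:E < +oo)%E.
  apply: le_lt_trans sq; apply: le_esum => i _.
  by rewrite lee_fin ge_max q0 /f opprB gerBl p0.
have : (\esum_(i in D) (Num.max (f i) 0)%:E + \esum_(i in D) (q i)%:E =
        \esum_(i in D) (p i)%:E + \esum_(i in D) (Num.max (- f i) 0)%:E)%E.
  rewrite -!esum_EFinD//; apply: eq_esum => i _; congr _%:E.
  by have := maxr0_posneg (f i); rewrite {1}/f; lra.
move/(congr1 fine); rewrite !fineD ?esum_EFin_fin// /rsum -/f; lra.
Qed.

Definition abs_summable D f := (\esum_(i in D) `|f i|%:E < +oo)%E.

Lemma abs_summable_posneg D f : abs_summable D f ->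
  (\esum_(i in D) (Num.max (f i) 0)%:E < +oo)%E /\
  (\esum_(i in D) (Num.max (- f i) 0)%:E < +oo)%E.
Proof.
by move=> sf; split; apply: le_lt_trans sf; apply: le_esum => i _;
  rewrite lee_fin maxr0_norm ?lerDl ?lerDr maxr0_ge0.
Qed.

Lemma le_abs_rsum D f : abs_summable D f ->
  `|rsum D f| <= fine (\esum_(i in D) `|f i|%:E).
Proof.
move=> sf; have [s1 s2] := abs_summable_posneg sf.
under eq_esum do rewrite maxr0_norm.
rewrite esum_EFinD ?fineD ?esum_EFin_fin// => [|i|i|i|i]; rewrite ?maxr0_ge0//.
apply: le_trans (ler_normB _ _) _.
by rewrite !ger0_norm// fine_ge0// esum_EFin_ge0// => i; rewrite maxr0_ge0.
Qed.

Lemma rsumB D f g : abs_summable D f -> abs_summable D g ->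
  rsum D (fun i => f i - g i) = rsum D f - rsum D g.
Proof.
move=> /abs_summable_posneg[f1 f2] /abs_summable_posneg[g1 g2].
rewrite (@eq_rsum _ _ (fun i => (Num.max (f i) 0 + Num.max (- g i) 0)
    - (Num.max (- f i) 0 + Num.max (g i) 0))) => [|i _]; last first.
  by have := maxr0_posneg (f i); have := maxr0_posneg (g i); lra.
have m0 (h : I -> R) i := maxr0_ge0 (h i).
have m1 (h : I -> R) i := maxr0_ge0 (- h i).
rewrite rsum_split ?esum_EFinD ?lte_add_pinfty//.
- by rewrite !fineD ?esum_EFin_fin// /rsum; lra.
- by move=> i; exact: addr_ge0.
- by move=> i; exact: addr_ge0.
Qed.

Lemma rsumZ D f (c : R) : abs_summable D f ->
  rsum D (fun i => c * f i) = c * rsum D f.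
Proof.
move=> /abs_summable_posneg[f1 f2].
have m0 i := maxr0_ge0 (f i); have m1 i := maxr0_ge0 (- f i).
have scal_lt p (a : R) : 0 <= a -> (forall i, 0 <= p i) ->
    (\esum_(i in D) (p i)%:E < +oo -> \esum_(i in D) (a * p i)%:E < +oo)%E.
  move=> a0 p0 sp; rewrite esum_EFinZl//.
  by rewrite -(fineK (esum_EFin_fin p0 sp)) -EFinM ltry.
have [c0|c0] := leP 0 c.
  rewrite (@eq_rsum _ _ (fun i => c * Num.max (f i) 0 - c * Num.max (- f i) 0)).
    rewrite rsum_split ?scal_lt//; do ?[by move=> i; exact: mulr_ge0].
    by rewrite !esum_EFinZl// !fineM ?esum_EFin_fin//= /rsum mulrBr.
  by move=> i _; rewrite {1}(maxr0_posneg (f i)) mulrBr.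
(* A negative factor exchanges the roles of the positive and negative parts. *)
have c0' : 0 <= - c by rewrite oppr_ge0 ltW.
rewrite (@eq_rsum _ _ (fun i => - c * Num.max (- f i) 0 - - c * Num.max (f i) 0)).
  rewrite rsum_split ?scal_lt//; do ?[by move=> i; exact: mulr_ge0].
  by rewrite !esum_EFinZl// !fineM ?esum_EFin_fin//= /rsum; lra.
by move=> i _; rewrite {1}(maxr0_posneg (f i)); lra.
Qed.

Lemma abs_summableZ D f (c : R) : abs_summable D f ->
  abs_summable D (fun i => c * f i).
Proof.
move=> sf; rewrite /abs_summable; under eq_esum do rewrite normrM.
by rewrite esum_EFinZl// -(fineK (esum_EFin_fin _ sf))// -EFinM ltry.
Qed.

Lemma abs_summable_le D f p : (forall i, D i -> `|f i| <= p i) ->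
  (\esum_(i in D) (p i)%:E < +oo)%E -> abs_summable D f.
Proof. by move=> fp; apply: le_lt_trans; apply: le_esum => i Di; rewrite lee_fin fp. Qed.

End RealSums.

(** * Sums over the vertices of the tree, grouped by generation and type *)

Section TreeSums.
Context {R : realType} {J : nat} (l : seq nat -> 'M[nat]_J) (i0 : 'I_J).

Let level n i := [set x | [/\ tree l i0 x, size x = n & vtype l i0 x = i]].

(** Induction on the generation, each vertex having finitely many children. Finiteness is what makes
    [population] a true count, since [fset_set] sends an infinite set to the empty one. *)
Lemma finite_tree_level n : finite_set [set x | tree l i0 x /\ size x = n].
Proof.
elim: n => [|n IHn].
  by apply: (@sub_finite_set _ _ [set [::]]) => // x [_ /size0nil].
(* [C x] is the set of children of [x]: by [child_type_some], their number is the column sum of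
   [l x] at the type of [x]. *)
pose C x := rcons x @` `I_(\sum_(i < J) l x i (vtype l i0 x)).
apply: (@sub_finite_set _ _
  (\bigcup_(x in [set x | tree l i0 x /\ size x = n]) C x)); last first.
  by apply: bigcup_finite => // x _; apply: finite_image.
move=> x /= [+ sx]; case/lastP: x sx => [//|x k]; rewrite size_rcons => -[sx].
rewrite /tree /= label_rcons; case lx: (label l i0 x) => [j|//] ck.
exists x; first by split=> //; rewrite /tree /= lx.
by exists k => //=; rewrite /vtype lx /= -child_type_some.
Qed.

Lemma finite_level n i : finite_set (level n i).
Proof. by apply: sub_finite_set (finite_tree_level n) => x [tx sx _]. Qed.

(** The tree is the disjoint union of its generations, and the summand is constant on the vertices
    of a given generation and type. As [G] is nonnegative, regrouping requires no summability. *)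
Lemma esum_tree (G : nat -> 'I_J -> R) : (forall n i, 0 <= G n i) ->
  (\esum_(x in tree l i0) (G (size x) (vtype l i0 x))%:E =
   \esum_(n in [set: nat]) (\sum_i G n i * population R l i0 n i 0)%:E)%E.
Proof.
move=> G0.
pose T n := [set x | tree l i0 x /\ size x = n].
have -> : tree l i0 = \bigcup_n T n.
  by apply/seteqP; split=> [x tx|x [n _ []]//]; exists (size x).
rewrite esum_bigcupT; last 2 first.
- by move=> m n _ _ [x [[_ <-] [_ <-]]].
- by move=> x; rewrite lee_fin.
apply: eq_esum => n _.
(* Each term is written as a sum over all types in which only the type of [x] contributes;
   exchanging the two sums then isolates each [level n i]. *)
transitivity (\esum_(x in T n) \sum_i
    if x \in level n i then (G n i)%:E else 0)%E.
  apply: eq_esum => x [tx sx]; rewrite (bigD1 (vtype l i0 x))//= big1 ?adde0.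
    by rewrite mem_set ?sx.
  by move=> i ix; rewrite memNset// => -[_ _ /esym/eqP]; rewrite (negbTE ix).
rewrite esum_sum => [|x i _ _]; last by case: ifP; rewrite ?lee_fin.
rewrite -sumEFin; apply: eq_bigr => i _.
rewrite -esum_mkcondr (_ : T n `&` level n i = level n i); last first.
  by apply/seteqP; split=> [x []//|x lx]; split=> //; case: lx.
rewrite esum_fset => [||x _]; last 2 first.
- exact: finite_level.
- by rewrite lee_fin.
rewrite fsbig_finite; last exact: finite_level.
transitivity (\sum_(x <- fset_set (level n i)) G n i)%:E; first by rewrite -sumEFin.
by rewrite big_const_seq count_predT iter_addr_0 mxE mulr_natr.
Qed.

(** The nonnegative case is applied to the two parts of [G]. After grouping, these need not be the
    positive and negative parts of the grouped family, so [rsum_split] is used to recombine them. *)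
Lemma rsum_tree (G : nat -> 'I_J -> R) :
  (\esum_(n in [set: nat]) (\sum_i `|G n i| * population R l i0 n i 0)%:E
   < +oo)%E ->
  abs_summable (tree l i0) (fun x => G (size x) (vtype l i0 x)) /\
  rsum (tree l i0) (fun x => G (size x) (vtype l i0 x)) =
  rsum [set: nat] (fun n => \sum_i G n i * population R l i0 n i 0).
Proof.
have z0 n i : 0 <= population R l i0 n i 0 by rewrite mxE.
have sum_ge0 (F : nat -> 'I_J -> R) n : (forall i, 0 <= F n i) ->
    0 <= \sum_i F n i * population R l i0 n i 0.
  by move=> F0; apply: sumr_ge0 => i _; rewrite mulr_ge0.
move=> sG; split; first by rewrite /abs_summable (esum_tree (G := fun n i => `|G n i|)).
have part_lt (F : nat -> 'I_J -> R) : (forall n i, 0 <= F n i <= `|G n i|) ->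
    (\esum_(n in [set: nat]) (\sum_i F n i * population R l i0 n i 0)%:E
     < +oo)%E.
  move=> FG; apply: le_lt_trans sG; apply: le_esum => n _; rewrite lee_fin.
  apply: ler_sum => i _; apply: ler_wpM2r => //.
  by have /andP[] := FG n i.
rewrite (@eq_rsum _ _ setT _ (fun n =>
    \sum_i Num.max (G n i) 0 * population R l i0 n i 0
    - \sum_i Num.max (- G n i) 0 * population R l i0 n i 0)) => [|n _].
  rewrite rsum_split; last 4 first.
  - by move=> n; apply: (sum_ge0 (fun n i => Num.max (G n i) 0)) => i; exact: maxr0_ge0.
  - by move=> n; apply: (sum_ge0 (fun n i => Num.max (- G n i) 0)) => i; exact: maxr0_ge0.
  - apply: (part_lt (fun n i => Num.max (G n i) 0)) => n i.
    by rewrite maxr0_ge0 (maxr0_norm (G n i)) lerDl maxr0_ge0.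
  - apply: (part_lt (fun n i => Num.max (- G n i) 0)) => n i.
    by rewrite maxr0_ge0 (maxr0_norm (G n i)) lerDr maxr0_ge0.
  rewrite -(esum_tree (G := fun n i => Num.max (G n i) 0)) => [|n i];
    last exact: maxr0_ge0.
  by rewrite -(esum_tree (G := fun n i => Num.max (- G n i) 0)) => [//|n i];
    exact: maxr0_ge0.
by rewrite -sumrB; apply: eq_bigr => i _; rewrite -mulrBl -maxr0_posneg.
Qed.

End TreeSums.

(** * Reindexing by generation, and a Toeplitz lemma *)

Lemma esum_int_le (R : realType) (n : nat) (F : int -> \bar R) :
  (\esum_(k in [set k : int | (k <= n%:Z)%R]) F k =
   \esum_(m in [set: nat]) F (n%:Z - m%:Z)%R)%E.
Proof.
apply: (@reindex_esum _ _ _ _ _ (fun m : nat => n%:Z - m%:Z)); split.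
- by move=> m _ /=; rewrite gerBl.
- by move=> m p _ _ /= e; lia.
- by move=> k /= kn; exists `|n%:Z - k|%N => //; lia.
Qed.

Lemma rsum_int_le (R : realType) (n : nat) (F : int -> R) :
  rsum [set k : int | (k <= n%:Z)%R] F =
  rsum [set: nat] (fun m => F (n%:Z - m%:Z)).
Proof. by rewrite /rsum !esum_int_le. Qed.

Lemma cvgr_bounded (R : realType) (a : nat -> R) (x : R) :
  a @ \oo --> x -> exists2 A : R, 0 <= A & forall n, `|a n| <= A.
Proof.
move=> ax; have /cvg_seq_bounded : cvgn a by apply/cvg_ex; exists x.
case=> B [Breal /(_ (Num.max 0 B + 1))]; set A := Num.max 0 B + 1.
have BA : B < A by rewrite /A ltr_pwDr// le_max lexx orbT.
move=> /(_ BA) aA; exists A; last by move=> n; exact: aA.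
by rewrite /A addr_ge0// le_max lexx.
Qed.

Lemma cvgr_sum (R : realType) (I : Type) (r : seq I) (f : I -> nat -> R)
    (x : I -> R) : (forall i, f i @ \oo --> x i) ->
  (fun n => \sum_(i <- r) f i n) @ \oo --> \sum_(i <- r) x i.
Proof.
move=> fx; elim: r => [|i r IHr].
  by under eq_fun do rewrite big_nil; rewrite big_nil; exact: cvg_cst.
by under eq_fun do rewrite big_cons; rewrite big_cons; apply: cvgD; [exact: fx|].
Qed.

(* A Toeplitz-type lemma: the indices [m] below a fixed [M] contribute finitely
   many terms [b (n - m) / s n], each vanishing because [s] is nondecreasing. *)
Lemma toeplitz (R : realType) (b : int -> R) (a s : nat -> R) (K : R) :
  (forall k, 0 <= b k) -> (forall m, 0 <= a m) -> a @ \oo --> (0 : R) ->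
  (forall n, (0 < n)%N -> 0 < s n) ->
  (forall m n, (0 < m)%N -> (m <= n)%N -> s m <= s n) ->
  (forall n, (0 < n)%N ->
     (\esum_(k in [set k : int | (k <= n%:Z)%R]) (b k)%:E <= (K * s n)%:E)%E) ->
  (fun n : nat => (s n)^-1 * b n%:Z) @ \oo --> (0 : R) ->
  (fun n : nat => (s n)^-1 *
     fine (\esum_(m in [set: nat]) (b (n%:Z - m%:Z) * a m)%R%:E)%E) @ \oo
    --> (0 : R).
Proof.
move=> b0 a0 a_cvg s0 s_mono bK b_cvg.
have [A A0 aA] := cvgr_bounded a_cvg.
have K0 : 0 <= K.
  have := bK 1 isT; move/(le_trans (esum_EFin_ge0 _ b0)); rewrite lee_fin.
  by rewrite pmulr_lge0 ?s0.
have term_cvg (m : nat) :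
    (fun n : nat => (s n)^-1 * b (n%:Z - m%:Z)) @ \oo --> (0 : R).
  have shifted : (fun n : nat => (s (n - m)%N)^-1 * b (n - m)%N%:Z) @ \oo --> (0 : R).
    rewrite -(cvg_shiftn m); apply: cvg_trans b_cvg; apply: near_eq_cvg.
    by near=> n; rewrite /= addnK.
  (* For [m < n], [s (n - m) <= s n] bounds the term by the shifted sequence
     [(s (n - m))^-1 * b (n - m)]. *)
  apply: (squeeze_cvgr _ (cvg_cst 0) shifted); near=> n.
  have mn : (m < n)%N by near: n; exact: nbhs_infty_gt.
  have sm : 0 < s (n - m)%N by rewrite s0 ?subn_gt0.
  have sn : 0 < s n by rewrite s0 ?(leq_trans _ mn).
  rewrite mulr_ge0 ?invr_ge0 ?(ltW sn)//= -subzn 1?ltnW// ler_wpM2r//.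
  by rewrite lef_pV2 ?posrE// s_mono ?leq_subr ?subn_gt0.
have head_cvg (M : nat) :
    (fun n : nat => \sum_(m < M) (s n)^-1 * b (n%:Z - m%:Z)) @ \oo --> (0 : R).
  have := @cvgr_sum _ _ (index_enum 'I_M) _ _ (fun m => term_cvg m).
  by rewrite big1_eq.
apply/cvgrPdist_lt => e e0.
(* The tail will cost at most [e1 * K <= e / 2], and the head less than [e / 2] by the choice of
   [e / (2 * (A + 1))]. Adding 1 keeps the denominators positive when [K] or [A] is 0. *)
pose e1 := e / (2 * (K + 1)).
have K1 : 0 < K + 1 by rewrite ltr_wpDl.
have e1_gt0 : 0 < e1 by rewrite divr_gt0// mulr_gt0.
have [M _ aM] := (cvgrPdist_lt _ _).1 a_cvg e1 e1_gt0.
have A1 : 0 < A + 1 by rewrite ltr_wpDl.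
have e2_gt0 : 0 < e / (2 * (A + 1)) by rewrite divr_gt0// mulr_gt0.
near=> n.
have n0 : (0 < n)%N by near: n; exact: nbhs_infty_gt.
have sn := s0 n n0.
have head_lt : \sum_(m < M) (s n)^-1 * b (n%:Z - m%:Z) < e / (2 * (A + 1)).
  have : `|0 - \sum_(m < M) (s n)^-1 * b (n%:Z - m%:Z)| < e / (2 * (A + 1)).
    near: n; exact: (cvgrPdist_lt _ _).1 (head_cvg M) _ e2_gt0.
  by rewrite sub0r normrN; apply: le_lt_trans; exact: ler_norm.
(* [c] bounds the head, where only [a m <= A] is available; beyond [M] the bound is [a m < e1]. *)
pose c m := if m \in `I_M then A * b (n%:Z - m%:Z) else 0.
have c0 m : 0 <= c m by rewrite /c; case: ifP => // _; rewrite mulr_ge0.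
have bound : (\esum_(m in [set: nat]) (b (n%:Z - m%:Z) * a m)%:E <=
    (e1 * (K * s n) + A * \sum_(m < M) b (n%:Z - m%:Z))%:E)%E.
  apply: (@le_trans _ _
    (\esum_(m in [set: nat]) (e1 * b (n%:Z - m%:Z) + c m)%:E)%E).
    apply: le_esum => m _; rewrite lee_fin /c; case: ifPn => mM.
      apply: ler_wpDl; first by rewrite mulr_ge0 ?(ltW e1_gt0).
      rewrite mulrC ler_wpM2r//.
      by apply: le_trans (aA m); exact: ler_norm.
    rewrite addr0 mulrC ler_wpM2r// ltW//.
    have Mm : (M <= m)%N by rewrite leqNgt; apply: contra mM => ?; rewrite inE.
    have := aM m Mm; rewrite /= sub0r normrN.
    by apply: le_lt_trans; exact: ler_norm.
  rewrite esum_EFinD => [|m|//]; last by rewrite mulr_ge0 ?(ltW e1_gt0).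
  rewrite EFinD; apply: leeD.
    rewrite (esum_EFinZl _ (ltW e1_gt0))// (EFinM e1).
    apply: lee_wpmul2l; first by rewrite lee_fin ltW.
    by rewrite -(esum_int_le _ (fun k => (b k)%:E)) bK.
  under eq_esum do rewrite /c (fun_if EFin).
  rewrite -esum_mkcondr setTI esum_fset => [||i _]; last 2 first.
  - exact: finite_II.
  - by rewrite lee_fin mulr_ge0.
  by rewrite -fsbig_ord sumEFin mulr_sumr.
rewrite sub0r normrN ger0_norm; last first.
  rewrite mulr_ge0 ?invr_ge0 ?(ltW sn)// fine_ge0// esum_EFin_ge0// => m.
  by rewrite mulr_ge0.
apply: (@le_lt_trans _ _ ((s n)^-1 *
    (e1 * (K * s n) + A * \sum_(m < M) b (n%:Z - m%:Z)))).
  rewrite ler_wpM2l ?invr_ge0 ?(ltW sn)// -lee_fin fineK//.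
  by rewrite esum_EFin_fin// ?(le_lt_trans bound) ?ltry// => m; rewrite mulr_ge0.
rewrite mulrDr [X in _ + X]mulrCA mulr_sumr.
have -> : (s n)^-1 * (e1 * (K * s n)) = e1 * K by field; rewrite gt_eqF.
have h1 : e1 * K <= e / 2.
  have -> : e / 2 = e1 * (K + 1) by rewrite /e1; field; rewrite gt_eqF.
  by rewrite ler_wpM2l ?(ltW e1_gt0)// lerDl.
have h2 : A * \sum_(m < M) (s n)^-1 * b (n%:Z - m%:Z) < e / 2.
  have -> : e / 2 = (A + 1) * (e / (2 * (A + 1))) by field; rewrite gt_eqF.
  apply: le_lt_trans (_ : (A + 1) * \sum_(m < M) (s n)^-1 * b (n%:Z - m%:Z) < _).
    rewrite ler_wpM2r ?lerDl// sumr_ge0// => i _.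
    by rewrite mulr_ge0 ?invr_ge0 ?(ltW sn).
  by rewrite ltr_pM2l.
lra.
Unshelve. all: by end_near. Qed.

(** * The comparison for a real characteristic along one fixed tree *)

Section RealCharacteristic.
Context {R : realType} {J : nat} (l : seq nat -> 'M[nat]_J) (i0 : 'I_J).
Variables (rho w : R) (u : 'cV[R]_J) (N : int -> R).
Hypothesis rho_gt0 : 0 < rho.
Let z n i := population R l i0 n i 0.
Hypothesis z_cvg : forall i, (fun n => (rho ^+ n)^-1 * z n i) @ \oo --> w * u i 0.
Hypothesis N_ge0 : forall k, 0 <= N k.
Let b k := N k * rho ^ (- k).
Hypothesis b_summable : forall n : nat,
  (\esum_(k in [set k : int | (k <= n%:Z)%R]) (b k)%:E < +oo)%E.

Let b_ge0 k : 0 <= b k.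
Proof. by rewrite /b mulr_ge0// exprz_ge0// ltW. Qed.

Let z_ge0 n i : 0 <= z n i.
Proof. by rewrite /z mxE. Qed.

Let rhoX_gt0 n : 0 < rho ^+ n.
Proof. exact: exprn_gt0. Qed.

Let rho_sub (n m : nat) : rho ^ (- (n%:Z - m%:Z)) = (rho ^+ n)^-1 * rho ^+ m.
Proof. by rewrite opprB addrC expfzDr ?gt_eqF -?invr_expz. Qed.

(** The normalised total population converges, hence is bounded by some [B], so the [m]-th term is
    at most [rho ^+ n * B * b (n - m)], and [b] is summable up to [n]. *)
Lemma esum_population_lt (n : nat) :
  (\esum_(m in [set: nat]) (\sum_i N (n%:Z - m%:Z) * z m i)%:E < +oo)%E.
Proof.
have total_cvg : (fun m => \sum_i (rho ^+ m)^-1 * z m i) @ \oo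
    --> \sum_i w * u i 0.
  exact: cvgr_sum.
have [B B0 zB] := cvgr_bounded total_cvg.
apply: (@le_lt_trans _ _
  (\esum_(m in [set: nat]) (rho ^+ n * B * b (n%:Z - m%:Z))%:E)%E).
  apply: le_esum => m _; rewrite lee_fin /b rho_sub.
  have -> : \sum_i N (n%:Z - m%:Z) * z m i
      = N (n%:Z - m%:Z) * rho ^+ m * \sum_i (rho ^+ m)^-1 * z m i.
    rewrite mulr_sumr; apply: eq_bigr => i _.
    by field; rewrite gt_eqF.
  have -> : rho ^+ n * B * (N (n%:Z - m%:Z) * ((rho ^+ n)^-1 * rho ^+ m))
      = N (n%:Z - m%:Z) * rho ^+ m * B by field; rewrite gt_eqF.
  rewrite ler_wpM2l ?mulr_ge0 ?(ltW (rhoX_gt0 _))//.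
  by apply: le_trans (zB m); exact: ler_norm.
rewrite esum_EFinZl ?mulr_ge0 ?(ltW (rhoX_gt0 _))//.
have := b_summable n; rewrite esum_int_le => bn.
by rewrite -(fineK (esum_EFin_fin _ bn))// -EFinM ltry.
Qed.

(** The scale [s] will be constant 1 for part i) and [n^gamma] for part ii). Positivity is asked
    only for [n > 0] because [n^gamma] vanishes at 0 when [gamma > 0]. *)
Variables (s : nat -> R) (K : R).
Hypothesis s_gt0 : forall n, (0 < n)%N -> 0 < s n.
Hypothesis s_mono : forall m n, (0 < m)%N -> (m <= n)%N -> s m <= s n.
Hypothesis b_bound : forall n, (0 < n)%N ->
  (\esum_(k in [set k : int | (k <= n%:Z)%R]) (b k)%:E <= (K * s n)%:E)%E.
Hypothesis b_cvg : (fun n : nat => (s n)^-1 * b n%:Z) @ \oo --> (0 : R).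
Variable phi : int -> 'I_J -> R.
Hypothesis phi_le : forall k i, `|phi k i| <= N k.

(** The characteristic [phi] enters only through the bound [N], so the real and imaginary parts of
    [Phi] can share the weights given by [hsnorm]. The error is dominated by the Toeplitz sum of
    [b (n - m) * a m], where [a m] is the l1 distance from [rho^-m Z_m] to [w u]. *)
Lemma rsum_tree_sub_cvg0 :
  (fun n : nat =>
    (s n)^-1 * (rho ^+ n)^-1 *
      rsum (tree l i0) (fun x => phi (n%:Z - (size x)%:Z) (vtype l i0 x))
    - w * ((s n)^-1 * rsum [set k : int | (k <= n%:Z)%R]
        (fun k => rho ^ (- k) * \sum_i phi k i * u i 0))) @ \oo --> (0 : R).
Proof.
pose a m := \sum_i `|(rho ^+ m)^-1 * z m i - w * u i 0|.
have a0 m : 0 <= a m by exact: sumr_ge0.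
have a_cvg : a @ \oo --> (0 : R).
  rewrite (_ : 0 = \sum_(i < J) 0); last by rewrite big1.
  apply: cvgr_sum => i; rewrite -(normr0 R) -(subrr (w * u i 0)).
  by apply: cvg_norm; apply: cvgB => //; exact: cvg_cst.
have T_cvg := toeplitz b_ge0 a0 a_cvg s_gt0 s_mono b_bound b_cvg.
have [A A0 aA] := cvgr_bounded a_cvg.
apply/norm_cvg0P; apply: (squeeze_cvgr _ (cvg_cst 0) T_cvg); near=> n.
have n0 : (0 < n)%N by near: n; exact: nbhs_infty_gt.
have sn := s_gt0 n0; rewrite normr_ge0 /=.
pose X m := \sum_i phi (n%:Z - m%:Z) i * z m i.
pose Y m := rho ^ (- (n%:Z - m%:Z)) * \sum_i phi (n%:Z - m%:Z) i * u i 0.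
have X_lt : (\esum_(m in [set: nat])
    (\sum_i `|phi (n%:Z - m%:Z) i| * z m i)%:E < +oo)%E.
  apply: le_lt_trans (esum_population_lt n); apply: le_esum => m _.
  by rewrite lee_fin; apply: ler_sum => i _; rewrite ler_wpM2r.
have [_ ->] := rsum_tree (G := fun m i => phi (n%:Z - m%:Z) i) X_lt.
rewrite rsum_int_le -/X -/Y.
have sX : abs_summable [set: nat] X.
  apply: abs_summable_le X_lt => m _; apply: le_trans (ler_norm_sum _ _ _) _.
  by apply: ler_sum => i _; rewrite normrM (ger0_norm (z_ge0 _ _)).
have bn : (\esum_(m in [set: nat]) (b (n%:Z - m%:Z))%:E < +oo)%E.
  by have := b_summable n; rewrite esum_int_le.
have sY : abs_summable [set: nat] Y.
  apply: (@abs_summable_le _ _ _ _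
    (fun m => (\sum_i `|u i 0|) * b (n%:Z - m%:Z))) => [m _|].
    rewrite normrM ger0_norm ?exprz_ge0 ?(ltW rho_gt0)// /b mulrA mulrC.
    rewrite ler_wpM2r ?exprz_ge0 ?(ltW rho_gt0)// mulrC mulr_sumr.
    apply: le_trans (ler_norm_sum _ _ _) _.
    by apply: ler_sum => i _; rewrite normrM ler_wpM2r.
  rewrite esum_EFinZl ?sumr_ge0//.
  by rewrite -(fineK (esum_EFin_fin _ bn))// -EFinM ltry.
have -> : (s n)^-1 * (rho ^+ n)^-1 * rsum [set: nat] X
    - w * ((s n)^-1 * rsum [set: nat] Y)
    = (s n)^-1 * rsum [set: nat] (fun m => (rho ^+ n)^-1 * X m - w * Y m).
  rewrite rsumB ?rsumZ; [ring|by []|by []|exact: abs_summableZ|exact: abs_summableZ].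
rewrite normrM (ger0_norm (_ : 0 <= (s n)^-1)) ?invr_ge0 ?(ltW sn)//.
rewrite ler_wpM2l ?invr_ge0 ?(ltW sn)//.
have ba_lt : (\esum_(m in [set: nat]) (b (n%:Z - m%:Z) * a m)%R%:E < +oo)%E.
  apply: (@le_lt_trans _ _ (\esum_(m in [set: nat]) (A * b (n%:Z - m%:Z))%:E)%E).
    apply: le_esum => m _; rewrite lee_fin mulrC ler_wpM2r//.
    by apply: le_trans (aA m); exact: ler_norm.
  by rewrite esum_EFinZl// -(fineK (esum_EFin_fin _ bn))// -EFinM ltry.
(* Both terms contain the factor [rho ^ (m - n)], by [rho_sub]; taking it out leaves [phi] applied
   to [rho^-m Z_m - w u]. *)
have XY_le m : `|(rho ^+ n)^-1 * X m - w * Y m| <= b (n%:Z - m%:Z) * a m.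
  have -> : (rho ^+ n)^-1 * X m - w * Y m = rho ^ (- (n%:Z - m%:Z)) *
      \sum_i phi (n%:Z - m%:Z) i * ((rho ^+ m)^-1 * z m i - w * u i 0).
    rewrite /X /Y rho_sub !mulr_sumr -sumrB; apply: eq_bigr => i _.
    by field; rewrite !gt_eqF.
  rewrite normrM ger0_norm ?exprz_ge0 ?(ltW rho_gt0)// /b mulrAC mulrC.
  rewrite ler_wpM2r ?exprz_ge0 ?(ltW rho_gt0)// /a mulr_sumr.
  apply: le_trans (ler_norm_sum _ _ _) _.
  by apply: ler_sum => i _; rewrite normrM ler_wpM2r.
have sXY : abs_summable [set: nat] (fun m => (rho ^+ n)^-1 * X m - w * Y m).
  by apply: abs_summable_le ba_lt => m _; exact: XY_le.
apply: le_trans (le_abs_rsum sXY) _.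
apply: fine_le; rewrite ?esum_EFin_fin//.
- by move=> m; rewrite mulr_ge0.
- by apply: le_esum => m _; rewrite lee_fin.
Unshelve. all: by end_near. Qed.

End RealCharacteristic.

(** * Reduction of complex limits to real and imaginary parts *)

Section ComplexParts.
Variable R : realType.
Implicit Types (z : R[i]) (c : R).

Lemma Re_realM c z : complex.Re (c%:C * z) = c * complex.Re z.
Proof. by case: z => a b /=; rewrite mul0r subr0. Qed.

Lemma Im_realM c z : complex.Im (c%:C * z) = c * complex.Im z.
Proof. by case: z => a b /=; rewrite mul0r addr0. Qed.

Lemma normRe_le_cmod z : `|complex.Re z| <= cmod z.
Proof.
by case: z => a b /=; rewrite -sqrtr_sqr ler_sqrt ?lerDl ?addr_ge0 ?sqr_ge0.
Qed.

Lemma normIm_le_cmod z : `|complex.Im z| <= cmod z.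
Proof.
by case: z => a b /=; rewrite -sqrtr_sqr ler_sqrt ?lerDr ?addr_ge0 ?sqr_ge0.
Qed.

Lemma cmod_le_ReIm z : cmod z <= `|complex.Re z| + `|complex.Im z|.
Proof.
case: z => a b /=; rewrite -[leRHS]ger0_norm ?addr_ge0// -sqrtr_sqr.
rewrite ler_wsqrtr// sqrrD !real_normK ?num_real// -addrA lerD2l lerDr.
by rewrite mulrn_wge0 ?mulr_ge0.
Qed.

Lemma cvgC_ReIm (f : nat -> R[i]) (x : R[i]) : f -->C x <->
  (fun n => complex.Re (f n)) @ \oo --> complex.Re x /\
  (fun n => complex.Im (f n)) @ \oo --> complex.Im x.
Proof.
have normE z : `|z : R[i]^o| = (cmod z)%:C by case: z.
split=> [/cvgrPdist_lt fx|[/cvgrPdist_lt fRe /cvgrPdist_lt fIm]].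
  split; apply/cvgrPdist_lt => e e0.
    have [|N _ fN] := fx e%:C; first by rewrite ltcR.
    exists N => // n /= /fN; rewrite normE ltcR; apply: le_lt_trans.
    by apply: le_trans (normRe_le_cmod _); rewrite raddfB.
  have [|N _ fN] := fx e%:C; first by rewrite ltcR.
  exists N => // n /= /fN; rewrite normE ltcR; apply: le_lt_trans.
  by apply: le_trans (normIm_le_cmod _); rewrite raddfB.
(* The order of [R[i]] compares only numbers with equal imaginary parts, so a positive [e] is
   real. *)
apply/cvgrPdist_lt => e; rewrite ltcE /= => /andP[/eqP eI eR].
have e2 : 0 < complex.Re e / 2 by rewrite divr_gt0.
have [N1 _ f1] := fRe _ e2; have [N2 _ f2] := fIm _ e2.
exists (maxn N1 N2) => // n /=; rewrite geq_max => /andP[/f1 h1 /f2 h2].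
rewrite normE ltcE /= eI eqxx /=; apply: le_lt_trans (cmod_le_ReIm _) _.
by move: h1 h2; rewrite /= !raddfB; lra.
Qed.

Lemma cmod_le_hsnorm n (A : 'rV[R[i]]_n) i : cmod (A 0 i) <= hsnorm A.
Proof.
have c0 z : 0 <= cmod z by case: z => a b; exact: sqrtr_ge0.
rewrite /hsnorm big_ord1 -[leLHS]ger0_norm// -sqrtr_sqr ler_wsqrtr//.
by rewrite (bigD1 i)//= lerDl sumr_ge0// => j _; rewrite sqr_ge0.
Qed.

End ComplexParts.

Lemma char_termE (R : realType) (J : nat) (Phi : int -> 'rV[R[i]]_J) l i0 n x :
  char_term Phi l i0 n x = Phi (n%:Z - (size x)%:Z) 0 (vtype l i0 x).
Proof. by rewrite /char_term -colE mxE. Qed.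

(** * The limit for a complex characteristic, at a general scale [s] *)

Section CharacteristicLimit.
Context {R : realType} {J : nat} (l : seq nat -> 'M[nat]_J) (i0 : 'I_J).
Variables (rho w : R) (u : 'cV[R]_J) (Phi : int -> 'rV[R[i]]_J).
Hypothesis rho_gt0 : 0 < rho.
Hypothesis pop_cvg :
  (fun n : nat => (rho ^+ n)^-1 *: population R l i0 n) @ \oo --> w *: u.
Let b k := hsnorm (Phi k) * rho ^ (- k).
Variables (s : nat -> R) (K : R).
Hypothesis s_gt0 : forall n, (0 < n)%N -> 0 < s n.
Hypothesis s_mono : forall m n, (0 < m)%N -> (m <= n)%N -> s m <= s n.
Hypothesis b_bound : forall n, (0 < n)%N ->
  (\esum_(k in [set k : int | (k <= n%:Z)%R]) (b k)%:E <= (K * s n)%:E)%E.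

Let pop_coord_cvg i :
  (fun n => (rho ^+ n)^-1 * population R l i0 n i 0) @ \oo --> w * u i 0.
Proof.
have h := cvg_comp _ _ pop_cvg (@coord_continuous R J 1 i 0 (w *: u)).
have -> : w * u i 0 = (w *: u) i 0 by rewrite mxE.
by apply: cvg_trans h; apply: near_eq_cvg; near=> n; rewrite /= !mxE.
Unshelve. all: by end_near. Qed.

Let b_summable (n : nat) :
  (\esum_(k in [set k : int | (k <= n%:Z)%R]) (b k)%:E < +oo)%E.
Proof.
(* [b_bound] says nothing at [n = 0], so the bound at [n.+1] is used. *)
apply: le_lt_trans (ltry (K * s n.+1)); apply: le_trans (b_bound (ltn0Sn n)).
by apply: sub_esum => k /= kn; apply: le_trans kn _; lia.
Qed.

(** Bounding each term by [hsnorm] removes the dependence on the type, and the sum over generations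
    is then finite by [esum_population_lt]. *)
Lemma csummable_char_term n : csummable (tree l i0) (char_term Phi l i0 n).
Proof.
have N0 k : 0 <= hsnorm (Phi k) by exact: sqrtr_ge0.
apply: (@le_lt_trans _ _ (\esum_(x in tree l i0)
    (hsnorm (Phi (n%:Z - (size x)%:Z)))%:E)%E).
  by apply: le_esum => x _; rewrite lee_fin char_termE cmod_le_hsnorm.
rewrite (esum_tree l i0 (G := fun m _ => hsnorm (Phi (n%:Z - m%:Z))))//.
exact: esum_population_lt pop_coord_cvg N0 b_summable n.
Qed.

Hypothesis b_cvg : (fun n : nat => (s n)^-1 * b n%:Z) @ \oo --> (0 : R).

Let summand k : R[i] := ((rho ^ (- k))%:C *: (Phi k *m cmx u)) 0 0.

(** [part] stands for [complex.Re] or [complex.Im]. Since [rho] and [u] are real, additivity and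
    real homogeneity carry [part] through [Phi k *m cmx u] onto the entries of [Phi k]. *)
Lemma rsum_part_cvg (part : R[i] -> R) (sigma : R) :
  {morph part : y z / y + z} ->
  (forall c z, part (c%:C * z) = c * part z) ->
  (forall z, `|part z| <= cmod z) ->
  (fun n : nat => (s n)^-1 *
     rsum [set k : int | (k <= n%:Z)%R] (fun k => part (summand k))) @ \oo
    --> sigma ->
  (fun n : nat => (s n * rho ^+ n)^-1 *
     rsum (tree l i0) (fun x => part (char_term Phi l i0 n x))) @ \oo
    --> sigma * w.
Proof.
move=> partD partM part_le sigma_cvg.
have part0 : part 0 = 0 by rewrite -(mul0r 0) partM mul0r.
have N0 k : 0 <= hsnorm (Phi k) by exact: sqrtr_ge0.
pose phi k i := part (Phi k 0 i).
have phi_le k i : `|phi k i| <= hsnorm (Phi k).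
  by apply: le_trans (part_le _) _; exact: cmod_le_hsnorm.
pose S n := (s n)^-1 *
  rsum [set k : int | (k <= n%:Z)%R] (fun k => part (summand k)).
pose X n := rsum (tree l i0) (fun x => part (char_term Phi l i0 n x)).
have diff_cvg :
    (fun n => (s n)^-1 * (rho ^+ n)^-1 * X n - w * S n) @ \oo --> (0 : R).
  have h := rsum_tree_sub_cvg0 rho_gt0 pop_coord_cvg N0 b_summable
    s_gt0 s_mono b_bound b_cvg phi_le.
  apply: cvg_trans h; apply: near_eq_cvg; apply: nearW => n /=.
  congr (_ * _ - w * (_ * _)); first by apply: eq_rsum => x _; rewrite char_termE.
  apply: eq_rsum => k _.
  rewrite /summand mxE partM mxE (big_morph part partD part0); congr (_ * _).
  by apply: eq_bigr => i _; rewrite mxE [in RHS]mulrC partM mulrC.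
(* Adding back [w * S n], which tends to [w * sigma], recovers the normalised process. *)
have sum_cvg := cvgD diff_cvg (cvgM (cvg_cst w) sigma_cvg).
rewrite add0r [w * sigma]mulrC in sum_cvg.
rewrite (_ : (fun n => _) = fun n =>
  ((s n)^-1 * (rho ^+ n)^-1 * X n - w * S n) + w * S n); first exact: sum_cvg.
by apply/funext => n; rewrite subrK invfM.
Qed.

Lemma char_process_cvg (sigma2 : R[i]) :
  (fun n => ((s n)^-1)%:C * csum [set k : int | k <= n%:Z] summand)
    -->C sigma2 ->
  (fun n => char_process Phi l i0 n / (s n * rho ^+ n)%:C) -->C sigma2 * w%:C.
Proof.
move=> /cvgC_ReIm[sRe sIm]; apply/cvgC_ReIm.
have divE z c : z / c%:C = (c^-1)%:C * z :> R[i] by rewrite mulrC fmorphV.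
rewrite [sigma2 * _]mulrC Re_realM Im_realM ![w * _]mulrC; split.
- have h : (fun n : nat => (s n)^-1 * rsum [set k : int | (k <= n%:Z)%R]
      (fun k => complex.Re (summand k))) @ \oo --> complex.Re sigma2.
    apply: cvg_trans sRe; apply: near_eq_cvg; apply: nearW => n.
    by rewrite Re_realM.
  have := rsum_part_cvg (raddfD _) (@Re_realM R) (@normRe_le_cmod R) h.
  apply: cvg_trans; apply: near_eq_cvg; apply: nearW => n.
  by rewrite divE Re_realM.
- have h : (fun n : nat => (s n)^-1 * rsum [set k : int | (k <= n%:Z)%R]
      (fun k => complex.Im (summand k))) @ \oo --> complex.Im sigma2.
    apply: cvg_trans sIm; apply: near_eq_cvg; apply: nearW => n.
    by rewrite Im_realM.
  have := rsum_part_cvg (raddfD _) (@Im_realM R) (@normIm_le_cmod R) h.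
  apply: cvg_trans; apply: near_eq_cvg; apply: nearW => n.
  by rewrite divE Im_realM.
Qed.

End CharacteristicLimit.

(** * Sums over all integers as limits of sums over [k <= n] *)

Section IntSums.
Variable R : realType.
Implicit Types (p f : int -> R).

(** Monotone convergence: every finite set of integers lies below the largest absolute value of its
    elements, so the partial sums have the full sum as supremum. *)
Lemma esum_int_cvg p : (forall k, 0 <= p k) ->
  (\esum_(k in [set: int]) (p k)%:E < +oo)%E ->
  (fun n : nat => fine (\esum_(k in [set k : int | (k <= n%:Z)%R]) (p k)%:E)%E)
    @ \oo --> fine (\esum_(k in [set: int]) (p k)%:E)%E.
Proof.
move=> p0 sp; apply: fine_cvg; rewrite fineK ?esum_EFin_fin//.
set E := fun n : nat => (\esum_(k in [set k : int | (k <= n%:Z)%R]) (p k)%:E)%E.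
have -> : (\esum_(k in [set: int]) (p k)%:E = ereal_sup (range E))%E.
  apply/eqP; rewrite eq_le; apply/andP; split; last first.
    by apply: ge_ereal_sup => _ [n _ <-]; exact: sub_esum.
  apply: ge_ereal_sup => _ [X [finX _] <-].
  pose n := \max_(k <- fset_set X) `|k|%N.
  apply: (@le_trans _ _ (E n)); last by apply: ereal_sup_ubound; exists n.
  apply: ereal_sup_ubound; exists X => //; split=> // k Xk /=.
  have : (`|k| <= n)%N.
    by apply: (@leq_bigmax_seq _ _ xpredT (fun k : int => `|k|%N) k) => //;
      rewrite in_fset_set ?inE.
  lia.
apply: ereal_nondecreasing_cvgn => m n mn; apply: sub_esum => k /= km.
by apply: le_trans km _; rewrite lez_nat.
Qed.

(** [p n.+1] is the difference of two consecutive partial sums, which have the same finite limit. *)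
Lemma int_summand_cvg0 p : (forall k, 0 <= p k) ->
  (\esum_(k in [set: int]) (p k)%:E < +oo)%E ->
  (fun n : nat => p n%:Z) @ \oo --> (0 : R).
Proof.
move=> p0 sp; have E_cvg := esum_int_cvg p0 sp.
set E := fun n : nat => _ in E_cvg.
have E_shift : (fun n => E n.+1) @ \oo --> fine (\esum_(k in [set: int]) (p k)%:E)%E.
  by rewrite (cvg_shiftS E).
have D_cvg := cvgB E_shift E_cvg; rewrite subrr in D_cvg.
rewrite -(cvg_shiftS (fun n : nat => p n%:Z)).
rewrite (_ : mk_sequence _ = fun n => E n.+1 - E n); first exact: D_cvg.
apply/funext => n /=; apply/esym/eqP; rewrite subr_eq addrC /E; apply/eqP.
have p_lt : (\esum_(k in [set k : int | (k <= n%:Z)%R]) (p k)%:E < +oo)%E.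
  exact: le_lt_trans (sub_esum _ _) sp.
rewrite (esumID [set k : int | k <= n%:Z]) => [|k _]; last by rewrite lee_fin.
rewrite (_ : _ `&` _ = [set k : int | k <= n%:Z]); last first.
  by apply/seteqP; split=> k /=; [case|split=> //]; lia.
rewrite (_ : _ `&` ~` _ = [set n.+1%:Z]); last first.
  apply/seteqP; split=> k /=; last by move=> ->; split; lia.
  by move=> [kn /negP]; lia.
by rewrite esum_set1 ?lee_fin// fineD ?esum_EFin_fin.
Qed.

Lemma rsum_int_cvg f : abs_summable [set: int] f ->
  (fun n : nat => rsum [set k : int | (k <= n%:Z)%R] f) @ \oo
    --> rsum [set: int] f.
Proof.
move=> /abs_summable_posneg[s1 s2].
by apply: cvgB; apply: esum_int_cvg => // k; exact: maxr0_ge0.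
Qed.

End IntSums.

(** Gives absolute convergence of the series defining [sigma2] in part i). Bounding every entry of
    [A] by [hsnorm A] produces the l1 norm of [u] as constant. *)
Lemma cmod_summand_le (R : realType) (J : nat) (u : 'cV[R]_J)
    (A : 'rV[R[i]]_J) (c : R) : 0 <= c ->
  cmod ((c%:C *: (A *m cmx u)) 0 0) <= (\sum_i `|u i 0|) * (hsnorm A * c).
Proof.
move=> c0; have normE (z : R[i]) : `|z| = (cmod z)%:C by case: z.
have c0C : 0 <= c%:C :> R[i] by rewrite lecR.
rewrite -lecR -normE mxE normrM mxE (ger0_norm c0C).
have -> : ((\sum_i `|u i 0|) * (hsnorm A * c))%:C
    = c%:C * \sum_i (hsnorm A * `|u i 0|)%:C.
  by rewrite -rmorph_sum -rmorphM /= -mulr_sumr; congr _%:C; ring.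
apply: ler_wpM2l => //; apply: le_trans (ler_norm_sum _ _ _) _.
apply: ler_sum => i _; rewrite normrM mxE normE.
have -> : `|(u i 0)%:C| = `|u i 0|%:C :> R[i].
  by rewrite normE /= expr0n addr0 sqrtr_sqr.
by rewrite -rmorphM /= lecR ler_wpM2r ?cmod_le_hsnorm.
Qed.

(** * The theorem, from the general limit with each of the two scales *)

Theorem proposition4p1 (R : realType) (d : measure_display)
    (T : measurableType d) (P : probability T R)
    (J : nat) (J_ge1 : (1 <= J)%N) (i0 : 'I_J)
    (* the generic offspring matrix, with independent columns *)
    (L : T -> 'M[nat]_J)
    (L_meas : measurable_mx L)
    (L_indep : independent_family P (fun (j : 'I_J) w => col j (L w)))
    (* its i.i.d. copies along the Ulam-Harris tree *)
    (Lu : seq nat -> T -> 'M[nat]_J)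
    (Lu_meas : forall x, measurable_mx (Lu x))
    (Lu_indep : independent_family P Lu)
    (Lu_copies : forall x, same_law P (Lu x) L)
    (rho : R) (rho_def : rho = spectral_radius (mean_mx P L))
    (GW1 : 1 < rho)
    (GW2 : exists n : nat,
       (0 < n)%N /\ forall i j, 0 < (mean_mx P L ^+ n) i j)
    (GW3_cov : \sum_(j < J) col_cov P L j != 0)
    (GW3_var : forall i j, ('V_P[entry R L i j] < +oo)%E)
    (* the Perron-Frobenius eigenvectors *)
    (u v : 'cV[R]_J)
    (u_gt0 : forall i, 0 < u i 0) (v_gt0 : forall i, 0 < v i 0)
    (u_eigen : mean_mx P L *m u = rho *: u)
    (v_eigen : v^T *m mean_mx P L = rho *: v^T)
    (uv1 : (u^T *m v) 0 0 = 1)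
    (* the Kesten-Stigum limit *)
    (W : {RV P >-> R})
    (W_lim : {ae P, forall w,
       (fun n : nat => (rho ^+ n)^-1 *: population R (Lu ^~ w) i0 n) @ \oo
         --> W w *: u})
    (Phi : int -> 'rV[R[i]]_J) :
  ((\esum_(k in [set: int]) (hsnorm (Phi k) * rho ^ (- k))%:E < +oo)%E ->
   let sigma2 : R[i] :=
     csum [set: int] (fun k => ((rho ^ (- k))%:C *: (Phi k *m cmx u)) 0 0) in
   {ae P, forall w,
      (forall n, csummable (tree (Lu ^~ w) i0)
                   (char_term Phi (Lu ^~ w) i0 n)) /\
      (fun n => char_process Phi (Lu ^~ w) i0 n / (rho ^+ n)%:C)
        -->C sigma2 * (W w)%:C})
  /\
  (forall (gamma : R) (sigma2 : R[i]), 0 <= gamma ->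
   (ereal_sup [set (n%:R `^ gamma)^-1%:E *
                   \esum_(k in [set k : int | (k <= n%:Z)%R])
                     (hsnorm (Phi k) * rho ^ (- k))%:E
              | n in [set n : nat | (1 <= n)%N]] < +oo)%E ->
   (fun n : nat => (n%:R `^ gamma * rho ^+ n)^-1 * hsnorm (Phi n%:Z)) @ \oo
     --> (0 : R) ->
   (fun n => ((n%:R `^ gamma)^-1)%:C *
             csum [set k : int | k <= n%:Z]
               (fun k => ((rho ^ (- k))%:C *: (Phi k *m cmx u)) 0 0))
     -->C sigma2 ->
   {ae P, forall w,
      (forall n, csummable (tree (Lu ^~ w) i0)
                   (char_term Phi (Lu ^~ w) i0 n)) /\
      (fun n => char_process Phi (Lu ^~ w) i0 n
                / (n%:R `^ gamma * rho ^+ n)%:C)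
        -->C sigma2 * (W w)%:C}).
Proof.
have rho_gt0 : 0 < rho by apply: lt_trans GW1.
pose b k := hsnorm (Phi k) * rho ^ (- k).
have b0 k : 0 <= b k by rewrite mulr_ge0 ?sqrtr_ge0 ?exprz_ge0 ?ltW.
split=> [b_sum sigma2|gamma sigma2 gamma0 b_sup b_cvg sigma2_cvg].
  (* The constant scale: the full sum of [b] serves as [K], and the other two conditions follow from
     summability. *)
  pose one (n : nat) : R := 1.
  have one_gt0 n : (0 < n)%N -> 0 < one n by [].
  have one_mono m n : (0 < m)%N -> (m <= n)%N -> one m <= one n by [].
  have b_bound (n : nat) : (0 < n)%N ->
      (\esum_(k in [set k : int | (k <= n%:Z)%R]) (b k)%:E <=
       (fine (\esum_(k in [set: int]) (b k)%:E) * one n)%:E)%E.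
    by move=> _; rewrite mulr1 fineK ?esum_EFin_fin//; exact: sub_esum.
  have b_cvg : (fun n : nat => (one n)^-1 * b n%:Z) @ \oo --> (0 : R).
    under eq_fun do rewrite invr1 mul1r.
    exact: int_summand_cvg0.
  have summand_le k : cmod (((rho ^ (- k))%:C *: (Phi k *m cmx u)) 0 0)
      <= (\sum_i `|u i 0|) * b k.
    by apply: cmod_summand_le; rewrite exprz_ge0 ?ltW.
  have summand_sum (part : R[i] -> R) : (forall z, `|part z| <= cmod z) ->
      abs_summable [set: int]
        (fun k => part (((rho ^ (- k))%:C *: (Phi k *m cmx u)) 0 0)).
    move=> part_le.
    apply: (@abs_summable_le _ _ _ _ (fun k => (\sum_i `|u i 0|) * b k)) => [k _|].
      exact: le_trans (part_le _) (summand_le k).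
    rewrite esum_EFinZl ?sumr_ge0//.
    by rewrite -(fineK (esum_EFin_fin _ b_sum))// -EFinM ltry.
  have sigma2_cvg : (fun n => ((one n)^-1)%:C * csum [set k : int | k <= n%:Z]
      (fun k => ((rho ^ (- k))%:C *: (Phi k *m cmx u)) 0 0)) -->C sigma2.
    apply/cvgC_ReIm; split.
      have := rsum_int_cvg (summand_sum _ (@normRe_le_cmod R)).
      apply: cvg_trans; apply: near_eq_cvg; apply: nearW => n.
      by rewrite Re_realM invr1 mul1r.
    have := rsum_int_cvg (summand_sum _ (@normIm_le_cmod R)).
    apply: cvg_trans; apply: near_eq_cvg; apply: nearW => n.
    by rewrite Im_realM invr1 mul1r.
  (* The sample point is fixed here, in the almost sure event of [W_lim]; what remains is
     deterministic. *)
  apply: filterS W_lim => w pop_cvg; split.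
    move=> n; exact: (csummable_char_term rho_gt0 pop_cvg b_bound n).
  have := char_process_cvg rho_gt0 pop_cvg one_gt0 one_mono b_bound b_cvg sigma2_cvg.
  by under eq_fun do rewrite mul1r.
pose s (n : nat) : R := n%:R `^ gamma.
have s_gt0 n : (0 < n)%N -> 0 < s n by move=> n0; rewrite powR_gt0 ?ltr0n.
have s_mono m n : (0 < m)%N -> (m <= n)%N -> s m <= s n.
  by move=> _ mn; rewrite ge0_ler_powR ?nnegrE ?ler0n ?ler_nat.
have [K b_bound] : exists K, forall n, (0 < n)%N ->
    (\esum_(k in [set k : int | (k <= n%:Z)%R]) (b k)%:E <= (K * s n)%:E)%E.
  (* [K] is the supremum in the first condition; its term at [n = 1] is nonnegative, so [M < +oo]
     makes it a real number. *)
  set M := ereal_sup _ in b_sup.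
  have le_M n : (0 < n)%N -> ((s n)^-1%:E *
      (\esum_(k in [set k : int | (k <= n%:Z)%R]) (b k)%:E) <= M)%E.
    by move=> n0; apply: ereal_sup_ubound; exists n.
  have M_fin : M \is a fin_num.
    rewrite ge0_fin_numE//; apply: le_trans (le_M 1 isT).
    by rewrite mule_ge0 ?esum_EFin_ge0 ?lee_fin ?invr_ge0 ?ltW ?s_gt0.
  exists (fine M) => n n0.
  by rewrite EFinM fineK// muleC -lee_pdivrMl ?s_gt0// le_M.
have b_cvg' : (fun n : nat => (s n)^-1 * b n%:Z) @ \oo --> (0 : R).
  apply: cvg_trans b_cvg; apply: near_eq_cvg; apply: nearW => n.
  by rewrite /b -invr_expz invfM -mulrA [hsnorm _ * _]mulrC.
apply: filterS W_lim => w pop_cvg; split.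
  move=> n; exact: (csummable_char_term rho_gt0 pop_cvg b_bound n).
have h := char_process_cvg rho_gt0 pop_cvg s_gt0 s_mono b_bound b_cvg' sigma2_cvg.
exact: h.
Qed.
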